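(* Let $S=K[x_1,\ldots,x_n]$ be a polynomial ring over a field $K$, and let $I=B_1(u_1,\ldots,u_m)\subset S$ be an equigenerated squarefree Borel ideal. Then $$\operatorname{HS}_1(I)=B_1(x_{p_1}u_1,\ldots,x_{p_m}u_m),$$ where for each $i$, $p_i$ is the maximal gap of $u_i$.
   Context: $\operatorname{supp}(u)=\{i:x_i\mid u\}$. A squarefree monomial ideal $I$ (one generated by squarefree monomials) is a squarefree Borel ideal (also called $1$-Borel) if for every squarefree monomial $u\in I$, every $j\in\operatorname{supp}(u)$ and every $i<j$ one has $x_i(u/x_j)\in I$, provided $x_i(u/x_j)$ is squarefree. For squarefree monomials $v_1,\ldots,v_r$, $B_1(v_1,\ldots,v_r)$ is the smallest squarefree Borel ideal containing $v_1,\ldots,v_r$; these monomials are called its Borel generators. A monomial ideal is equigenerated if all its minimal monomial generators have the same degree. For a squarefree monomial $u$, a gap of $u$ is a positive integer $i<\max(\operatorname{supp}(u))$ such that $x_i$ does not divide $u$; the maximal gap of $u$ is the largest gap of $u$. For a monomial ideal $I\subset S$ with minimal $\mathbb Z^n$-graded free $S$-resolution $\mathbb F$ of $I$, $F_i=\bigoplus_{j=1}^{b_i}S(-\mathbf a_{ij})$, the $i$th homological shift ideal of $I$ is $\operatorname{HS}_i(I)=(\mathbf x^{\mathbf a_{ij}}: j=1,\ldots,b_i)$; in particular $\operatorname{HS}_0(I)=I$.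
   Formalization: The u_i are assumed to be minimal monomial generators of I (otherwise false: for B_1(x_2, x_2x_4) = (x_1, x_2), HS_1 = (x_1x_2) lacks x_2x_3x_4), and a u_i = x_1...x_d, which has no gap, contributes no generator on the right. *)

(* Defs.v *)
From HB Require Import structures.
From mathcomp Require Import all_boot all_order all_algebra.
From mathcomp Require Import mpoly.
Set Implicit Arguments.
Unset Strict Implicit.
Unset Printing Implicit Defensive.
Import GRing.Theory.
Local Open Scope ring_scope.

(* A monomial x^m of S = K[x_1, ..., x_n] is represented by its exponent
   vector m : 'X_{1..n}; the variables are indexed from 0 by 'I_n.  Ideals of S
   are predicates on {mpoly K[n]}, compared extensionally. *)

Section Monomials.
Context {n : nat}.
Implicit Types (m u : 'X_{1..n}) (i p : 'I_n).

Definition squarefree u : Prop := forall i, (u i <= 1)%N.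

Definition supp u : {set 'I_n} := [set i | (0 < u i)%N].

(* The \max over an empty support is 0, so that 1 has no gap. *)
Definition gap u i : bool :=
  (i < \max_(j in supp u) (j : nat))%N && (i \notin supp u).

(* No p qualifies when u = x_1 ... x_d. *)
Definition maximal_gap u p : Prop :=
  gap u p /\ (forall i, gap u i -> (i <= p)%N).

Definition multidegree m : 'rV[int]_n := \row_i (m i)%:Z.

End Monomials.

Section Ideals.
Context {K : fieldType} {n : nat}.
Implicit Types (I J : {mpoly K[n]} -> Prop) (M V : 'X_{1..n} -> Prop).

Definition monomial_ideal M (f : {mpoly K[n]}) : Prop :=
  exists (r : nat) (c : 'I_r -> {mpoly K[n]}) (m : 'I_r -> 'X_{1..n}),
    (forall k, M (m k)) /\ f = \sum_(k < r) c k * 'X_[m k].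

Definition squarefree_monomial_ideal I : Prop :=
  exists M, (forall m, M m -> squarefree m) /\
            (forall f, I f <-> monomial_ideal M f).

Definition squarefree_Borel I : Prop :=
  squarefree_monomial_ideal I /\
  forall u : 'X_{1..n}, squarefree u -> I 'X_[u] ->
  forall i j : 'I_n, j \in supp u -> (i < j)%N ->
    squarefree (U_(i) + (u - U_(j)))%MM -> I 'X_[U_(i) + (u - U_(j))].

(* I = B_1(V). *)
Definition is_B1 V I : Prop :=
  [/\ squarefree_Borel I,
      forall v, V v -> I 'X_[v]
    & forall J, squarefree_Borel J -> (forall v, V v -> J 'X_[v]) ->
        forall f, I f -> J f].

(* x^m belongs to the minimal monomial generating set G(I). *)
Definition minimal_generator I (m : 'X_{1..n}) : Prop :=
  I 'X_[m] /\
  forall m' : 'X_{1..n}, I 'X_[m'] -> (m' <= m)%MM -> m' = m.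

Definition equigenerated I : Prop :=
  forall m m', minimal_generator I m -> minimal_generator I m' ->
    mdeg m = mdeg m'.

End Ideals.

(* Augmented sequence ... -> F_2 -> F_1 -> F_0 -> S of Z^n-graded free modules
   F_i = (+)_j S(-res_shift i j), whose elements are row vectors; the maps
   act by right multiplication, so that row j of res_diff i is the image in F_i
   of the j-th basis element of F_(i+1). *)
Record graded_free_sequence (K : fieldType) (n : nat) := GradedFreeSequence {
  res_rank : nat -> nat;
  res_shift : forall i, 'I_(res_rank i) -> 'rV[int]_n;
  res_diff : forall i, 'M[{mpoly K[n]}]_(res_rank i.+1, res_rank i);
  res_aug : 'cV[{mpoly K[n]}]_(res_rank 0)
}.

Section Resolutions.
Context {K : fieldType} {n : nat}.
Implicit Types (F : graded_free_sequence K n) (I : {mpoly K[n]} -> Prop).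

(* The maps preserve the Z^n-degree. *)
Definition multigraded F : Prop :=
  (forall (k : 'I_(res_rank F 0)) (m : 'X_{1..n}),
      m \in msupp (res_aug F k 0) -> multidegree m = res_shift k) /\
  (forall i (j : 'I_(res_rank F i.+1)) (k : 'I_(res_rank F i)) (m : 'X_{1..n}),
      m \in msupp (res_diff F i j k) ->
      multidegree m + res_shift k = res_shift j).

Definition resolves F I : Prop :=
  [/\ forall f, I f <->
        exists v : 'rV[{mpoly K[n]}]_(res_rank F 0), f = (v *m res_aug F) 0 0,
      forall v : 'rV[{mpoly K[n]}]_(res_rank F 0),
        v *m res_aug F = 0 <-> exists w, v = w *m res_diff F 0
    & forall i (v : 'rV[{mpoly K[n]}]_(res_rank F i.+1)),
        v *m res_diff F i = 0 <-> exists w, v = w *m res_diff F i.+1].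

(* F_(i+1) is mapped into (x_1, ..., x_n) F_i. *)
Definition minimal F : Prop :=
  forall i (j : 'I_(res_rank F i.+1)) (k : 'I_(res_rank F i)),
    (res_diff F i j k)@_0%MM = 0.

Definition minimal_graded_free_resolution F I : Prop :=
  [/\ multigraded F, resolves F I & minimal F].

(* HS_i(I), when F is a minimal Z^n-graded free resolution of I; it does not
   depend on the choice of F, and all the shifts of F then lie in N^n. *)
Definition HS F (i : nat) : {mpoly K[n]} -> Prop :=
  monomial_ideal
    (fun m => exists j : 'I_(res_rank F i), res_shift j = multidegree m).

End Resolutions.

(* Main.v *)
Require Import Defs.
From HB Require Import structures.
From mathcomp Require Import all_boot all_order all_algebra zify.
From mathcomp Require Import mpoly.
Set Implicit Arguments.
Unset Strict Implicit.
Unset Printing Implicit Defensive.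
Import GRing.Theory.
Local Open Scope ring_scope.

(** Let [G] be the set of minimal generators of [I]; its elements all have the
    same degree, so it is stable under the Borel moves, which trade a variable
    [x_t] for a missing [x_s] with [s < t].  The heart of the argument is that
    the multidegrees of the minimal first syzygies of [I] are exactly the
    monomials [x_i v] with [v] in [G] and [i] a gap of [v].

    - Each such monomial occurs ([gap_multiple_shift]).  If [x_t] divides [v] and
      [i < t], then [w = x_i v / x_t] is again in [G], and [x_i e_v - x_t e_w] is
      a syzygy.  Its coordinate [x_i] along [e_v] must come from a basis
      element of [F_1] whose image has there a multiple of [x_i] by a nonzero
      scalar, because the entries of the differential have no constant term.

    - Nothing else occurs ([shift_gap_multiple]).  If a multidegree [a] is not of
      this form, then the generators dividing [x^a] are connected to one another
      by the syzygies above, each multiplied by a nontrivial monomial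
      ([gens_connected]).  So every syzygy of multidegree [a] lies in the maximal
      ideal times the syzygy module, and no minimal syzygy does.

    Hence [HS_1(I)] is generated by the monomials [x_i v], a set that is stable
    under Borel moves, so it is a squarefree Borel ideal; it contains every
    [x_(p_k) u_k].  Conversely let [J] be a squarefree Borel ideal containing the
    [x_(p_k) u_k].  The squarefree monomials [w] of [I] such that [x_i w] is in
    [J] for every gap [i] of [w] are stable under Borel moves and include the [u_k], as
    the maximal gap can be moved down to any other gap.  By minimality of
    [B_1(u_1, ..., u_m)] they include all of [G] ([gap_multiples_B1]), so that
    [J] contains [HS_1(I)]. *)

(** * Borel moves and gaps *)

Section Moves.
Context {n : nat}.
Implicit Types (u v w : 'X_{1..n}) (i j k s t : 'I_n) (M : 'X_{1..n} -> Prop).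

(** The Borel move x_s (v / x_t).  The subtraction is truncated, so this is
    meaningful only when x_t divides v. *)
Definition bmove s t v : 'X_{1..n} := (U_(s) + (v - U_(t)))%MM.

Lemma bmoveE s t v k : bmove s t v k = ((s == k) + (v k - (t == k)))%N.
Proof. by rewrite mnmDE mnmBE !mnm1E. Qed.

Lemma bmove_notin s t v k : s != k -> t != k -> bmove s t v k = v k.
Proof. by rewrite bmoveE => /negbTE-> /negbTE->; rewrite subn0. Qed.

Lemma bmoveK s t v : (0 < v t)%N -> (U_(t) + bmove s t v = U_(s) + v)%MM.
Proof.
move=> vt; apply/mnmP => x; rewrite !mnmDE mnmBE !mnm1E.
by case: (eqVneq t x) => [<-|_] /=; lia.
Qed.

Lemma mdeg_bmove s t v : (0 < v t)%N -> mdeg (bmove s t v) = mdeg v.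
Proof.
by move=> /(bmoveK s)/(congr1 mdeg); rewrite !mdegD !mdeg1 => -[].
Qed.

(** Stability of a set of monomials under the moves that replace x_t by a
    smaller missing variable x_s. *)
Definition Borel_closed M : Prop :=
  forall v s t, M v -> (s < t)%N -> v s = 0%N -> (0 < v t)%N -> M (bmove s t v).

(** A gap of v, with an explicit larger variable dividing v instead of the
    maximum of the support. *)
Definition has_gap v i : Prop := v i = 0%N /\ exists2 k : 'I_n, (i < k)%N & (0 < v k)%N.

Lemma gapP v i : reflect (has_gap v i) (gap v i).
Proof.
rewrite /gap inE -eqn0Ngt; apply: (iffP andP) => [[lt_i /eqP vi] | [vi [k lt_ik vk]]].
  split=> //; apply/exists_inP.
  apply: contraTT lt_i => /exists_inPn small; rewrite -leqNgt.
  by apply/bigmax_leqP => k; rewrite inE => vk; rewrite leqNgt;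
     apply: contraL vk => /small.
split; last by rewrite vi.
by apply: leq_trans lt_ik _; apply: leq_bigmax_cond; rewrite inE.
Qed.

Lemma squarefree_bmove s t v : squarefree v -> v s = 0%N -> squarefree (bmove s t v).
Proof.
move=> sv vs k; rewrite bmoveE.
by have := sv k; case: (eqVneq s k) => [<-|_] /=; rewrite ?vs; lia.
Qed.

(** The monomials x_i v, for v in M and i a gap of v. *)
Definition gap_multiples M w : Prop :=
  exists v i, [/\ M v, has_gap v i & w = (U_(i) + v)%MM].

Lemma squarefree_gap_multiples M :
  (forall v, M v -> squarefree v) -> forall w, gap_multiples M w -> squarefree w.
Proof.
move=> sM _ [v [i [/sM sv [vi _] ->]]] k; rewrite mnmDE mnm1E.
by have := sv k; case: (eqVneq i k) => [<-|_] /=; rewrite ?vi; lia.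
Qed.

Lemma addm_bmoveC i s t v :
  i != t -> (U_(i) + bmove s t v = bmove s t (U_(i) + v))%MM.
Proof.
move=> it; apply/mnmP => x; rewrite !(mnmDE, mnmBE, mnm1E).
by case: (eqVneq t x) => [<-|_] /=; rewrite ?(negbTE it); lia.
Qed.

Lemma bmove_gap s i v : v i = 0%N -> (bmove s i (U_(i) + v) = U_(s) + v)%MM.
Proof.
move=> vi; apply/mnmP => x; rewrite !(mnmDE, mnmBE, mnm1E).
by case: (eqVneq i x) => [<-|_] /=; lia.
Qed.

(** Let A = x_i v, with x_k dividing v and i < k, and replace x_t by x_s in A.
    If t = i, then s takes the place of i as a gap of v.  Otherwise move x_t to
    x_s in v, unless t = k and s < i: then x_k is moved to x_i instead, and s is
    the gap. *)
Lemma Borel_closed_gap_multiples M : Borel_closed M -> Borel_closed (gap_multiples M).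
Proof.
move=> cM _ s t [v [i [Mv [vi [k ltik vk]] ->]]] ltst.
rewrite !mnmDE !mnm1E => As At.
have vs : v s = 0%N by lia.
have si : s != i by apply/eqP => e; move: As; rewrite e eqxx.
case: (eqVneq i t) At => [eit _ | it /= vt].
  rewrite -eit bmove_gap //; exists v, s; split=> //; split=> //; exists k => //.
  by apply: ltn_trans ltik; rewrite eit.
case: (eqVneq t k) => [etk | tk]; last first.
  exists (bmove s t v), i; rewrite addm_bmoveC //; split=> //; first exact: cM.
  split; first by rewrite bmove_notin // eq_sym.
  exists k => //; rewrite bmove_notin //.
  by apply: contraTneq vk => <-; rewrite vs.
subst k; have [lt_is | le_si] := ltnP i s.
  exists (bmove s t v), i; rewrite addm_bmoveC //; split=> //; first exact: cM.
  split; first by rewrite bmove_notin // eq_sym.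
  by exists s => //; rewrite bmoveE eqxx.
have lt_si : (s < i)%N by rewrite ltn_neqAle le_si andbT; exact: si.
exists (bmove i t v), s; split; first exact: cM.
  split; last by exists i => //; rewrite bmoveE eqxx.
  by rewrite bmove_notin // ?(eq_sym i) //; apply: contraTneq ltst => ->; rewrite ltnn.
rewrite addm_bmoveC; last by apply: contraTneq ltst => ->; rewrite ltnn.
apply/mnmP => x; rewrite !(mnmDE, mnmBE, mnm1E).
by case: (eqVneq t x) => [<-|_] /=; rewrite ?(negbTE it); lia.
Qed.

End Moves.

(** * Monomial ideals stable under Borel moves *)

Section MonomialIdeals.
Context {K : fieldType} {n : nat}.
Implicit Types (I J : {mpoly K[n]} -> Prop) (M : 'X_{1..n} -> Prop).

Lemma monomial_idealX M (u : 'X_{1..n}) :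
  @monomial_ideal K n M 'X_[u] <-> exists2 m, M m & (m <= u)%MM.
Proof.
split=> [[r [c [m [Mm eqX]]]] | [m Mm le_mu]]; last first.
  exists 1%N, (fun=> 'X_[u - m]), (fun=> m); split=> //.
  by rewrite big_ord1 -mpolyXD submK.
have: u \in msupp ('X_[u] : {mpoly K[n]}) by rewrite msuppX inE.
rewrite eqX => /msupp_sum_le/flattenP[_ /mapP[k _ ->]].
rewrite (perm_mem (msuppMX _ _)) => /mapP[v _ ->].
by exists (m k) => //; apply: lem_addr.
Qed.

Lemma monomial_ideal_sub M M' :
  (forall m, M m -> @monomial_ideal K n M' 'X_[m]) ->
  forall f, @monomial_ideal K n M f -> monomial_ideal M' f.
Proof.
move=> sMM' _ [r [c [m [Mm ->]]]].
have /fin_all_exists2[m' M'm' le_m'] k : exists2 m', M' m' & (m' <= m k)%MM.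
  exact/monomial_idealX/sMM'.
exists r, (fun k => c k * 'X_[m k - m' k]), m'; split=> //.
by apply: eq_bigr => k _; rewrite -mulrA -mpolyXD submK.
Qed.

Lemma squarefree_monomial_ideal_sub M J :
    squarefree_monomial_ideal J -> (forall m, M m -> J 'X_[m]) ->
  forall f, monomial_ideal M f -> J f.
Proof.
move=> [MJ [_ defJ]] sMJ f /(@monomial_ideal_sub _ MJ) If.
by apply/defJ/If => m /sMJ /defJ.
Qed.

Lemma bmove_le s t (w u : 'X_{1..n}) : (w <= u)%MM -> (bmove s t w <= bmove s t u)%MM.
Proof.
by move=> /mnm_lepP le_wu; apply/mnm_lepP => k; rewrite !bmoveE; have := le_wu k; lia.
Qed.

(** It is enough to test the Borel property on squarefree generators. *)
Lemma squarefree_Borel_ideal M :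
    (forall m, M m -> squarefree m) -> Borel_closed M ->
  @squarefree_Borel K n (monomial_ideal M).
Proof.
move=> sM cM; split; first by exists M.
move=> u _ /monomial_idealX[w Mw le_wu] s t.
rewrite inE => ut ltst /(_ s); rewrite -/(bmove s t u) bmoveE eqxx => us.
apply/monomial_idealX; have /mnm_lepP le_wu' := le_wu.
have ts : t != s by apply: contraTneq ltst => ->; rewrite ltnn.
have ws : w s = 0%N by have := le_wu' s; move: us; rewrite (negbTE ts) /=; lia.
have [wt | wt] := posnP (w t).
  exists w => //; apply/mnm_lepP => k; rewrite bmoveE; have := le_wu' k.
  by case: (eqVneq t k) => [<-|_]; rewrite ?wt //=; lia.
by exists (bmove s t w); [apply: cM | apply: bmove_le].
Qed.

Lemma squarefree_Borel_closed J :
  squarefree_Borel J -> Borel_closed (fun v => squarefree v /\ J 'X_[v]).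
Proof.
move=> [_ BJ] v s t [sv Jv] ltst vs vt; have sv' := squarefree_bmove t sv vs.
by split=> //; apply: BJ => //; rewrite inE.
Qed.

(** Let w' = x_s (w / x_t) and let i be a gap of w'.  If i = t, then
    x_t w' = x_s w and s is a gap of w; otherwise i is a gap of w and x_i w' is a
    Borel move of x_i w. *)
Lemma Borel_closed_all_gaps J : squarefree_Borel J ->
  Borel_closed (fun w : 'X_{1..n} => squarefree w /\
    forall i, has_gap w i -> J 'X_[U_(i) + w]).
Proof.
move=> BJ w s t [sw Jw] ltst ws wt; split; first exact: squarefree_bmove.
move=> i [w'i [k ltik w'k]].
have ts : t != s by apply: contraTneq ltst => ->; rewrite ltnn.
have si : s != i by apply/eqP => e; move: w'i; rewrite bmoveE e eqxx.
case: (eqVneq i t) => [-> | it].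
  by rewrite bmoveK //; apply: Jw; split=> //; exists t.
have wi : w i = 0%N by rewrite -w'i bmove_notin // eq_sym.
have gap_i : has_gap w i.
  split=> //; case: (eqVneq s k) => [esk | sk].
    by exists t => //; apply: ltn_trans ltst; rewrite esk.
  by exists k => //; move: w'k; rewrite bmoveE (negbTE sk); lia.
have sA : squarefree (U_(i) + w).
  apply: (@squarefree_gap_multiples _ (@squarefree n)) => //.
  by exists w, i.
rewrite addm_bmoveC //.
apply: (squarefree_Borel_closed BJ (conj sA (Jw i gap_i)) ltst _ _).2.
  by rewrite mnmDE mnm1E eq_sym (negbTE si) ws.
by rewrite mnmDE mnm1E (negbTE it).
Qed.

(** Multiplying the Borel generators by their maximal gaps controls all the
    products x_i v, v a minimal generator and i any gap of v. *)
Lemma gap_multiples_B1 (V : 'X_{1..n} -> Prop) I J :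
    (forall v, V v -> squarefree v) -> is_B1 V I -> squarefree_Borel J ->
    (forall v p, V v -> maximal_gap v p -> J 'X_[U_(p) + v]) ->
  forall w, gap_multiples (minimal_generator I) w -> J 'X_[w].
Proof.
move=> sV [BI VI minI] BJ VJ _ [v [i [[Iv minv] gap_i ->]]].
pose N (w : 'X_{1..n}) := (squarefree w /\ I 'X_[w]) /\
  (squarefree w /\ forall i, has_gap w i -> J 'X_[U_(i) + w]).
have BN : @squarefree_Borel K n (monomial_ideal N).
  apply: squarefree_Borel_ideal => [w [[]] //|w s t [N1 N2] ltst ws wt].
  by split; [apply: (squarefree_Borel_closed BI) | apply: Borel_closed_all_gaps].
have VN w : V w -> @monomial_ideal K n N 'X_[w].
  move=> Vw; apply/monomial_idealX; exists w; last exact: lepm_refl.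
  have sw := sV w Vw; split; first by split=> //; apply: VI.
  split=> // g /gapP gap_g; pose p := [arg max_(k > g | gap w k) (k : nat)].
  (* Every gap g lies below the maximal gap p, so x_g w is a move of x_p w. *)
  have [gap_p max_p] : maximal_gap w p.
    by rewrite /p; case: arg_maxnP.
  have Jp := VJ w p Vw (conj gap_p max_p).
  have [wp [k ltpk wk]] := gapP _ _ gap_p; have [wg _] := gapP _ _ gap_g.
  case: (eqVneq g p) => [-> // | gp].
  have ltgp : (g < p)%N by rewrite ltn_neqAle max_p // andbT; exact: gp.
  rewrite -(bmove_gap g wp).
  apply: (squarefree_Borel_closed BJ _ ltgp _ _).2.
  - split=> //; apply: (@squarefree_gap_multiples _ (@squarefree n)) => //.
    by exists w, p; split=> //; apply/gapP.
  - by rewrite mnmDE mnm1E eq_sym (negbTE gp).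
  - by rewrite mnmDE mnm1E eqxx.
(* As N consists of monomials of I, minimality of v puts v itself in N. *)
have /monomial_idealX[w [[_ Iw] [_ Jw]] le_wv] := minI _ BN VN _ Iv.
by move: gap_i; rewrite -(minv w Iw le_wv); apply: Jw.
Qed.

End MonomialIdeals.

(** * Multidegrees and monomials *)

Section Multidegrees.
Context {n : nat}.
Implicit Types m : 'X_{1..n}.

Lemma multidegreeD m m' : multidegree (m + m')%MM = multidegree m + multidegree m'.
Proof. by apply/rowP => i; rewrite !mxE mnmDE PoszD. Qed.

Lemma multidegree_inj : injective (@multidegree n).
Proof.
by move=> m m' /rowP eq_mm'; apply/mnmP => i; have := eq_mm' i; rewrite !mxE => -[].
Qed.

Lemma subm_addK (m v a : 'X_{1..n}) :
  (m + v <= a)%MM -> (a - v = (a - (m + v)) + m)%MM.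
Proof.
move=> /mnm_lepP le_a; apply/mnmP => x; have := le_a x.
by rewrite !(mnmDE, mnmBE); lia.
Qed.

Lemma lepm_mdeg_eq m m' : (m <= m')%MM -> mdeg m = mdeg m' -> m = m'.
Proof.
move=> le_mm' eq_deg; rewrite -(submK le_mm').
have /eqP : mdeg (m' - m)%MM = 0%N.
  by have := congr1 mdeg (submK le_mm'); rewrite mdegD; lia.
by rewrite mdeg_eq0 => /eqP->; rewrite add0m.
Qed.

End Multidegrees.

Section Polynomials.
Context {K : fieldType} {n : nat}.

Lemma mpoly_monomialE (f : {mpoly K[n]}) (b : 'X_{1..n}) :
  (forall m, m \in msupp f -> m = b) -> f = f@_b *: 'X_[b].
Proof.
move=> supp_f; apply/mpolyP => m; rewrite mcoeffZ mcoeffX.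
case: (eqVneq b m) => [-> | neq_bm]; first by rewrite mulr1.
rewrite mulr0; apply: memN_msupp_eq0; apply/negP => /supp_f eq_mb.
by rewrite eq_mb eqxx in neq_bm.
Qed.

Lemma mcoeff0M (p q : {mpoly K[n]}) : (p * q)@_0%MM = p@_0%MM * q@_0%MM.
Proof. exact: rmorphM. Qed.

Lemma mulmx_mcoeff0 (r s : nat) (w : 'rV[{mpoly K[n]}]_r) (D : 'M_(r, s)) k :
  (forall j, (D j k)@_0%MM = 0) -> ((w *m D) 0 k)@_0%MM = 0.
Proof.
by move=> D0; rewrite mxE raddf_sum big1 //= => j _; rewrite mcoeff0M D0 mulr0.
Qed.

End Polynomials.

(** * First syzygies of an equigenerated squarefree Borel ideal *)

Section MinimalResolution.
Context {K : fieldType} {n : nat} {F : graded_free_sequence K n}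
  {I : {mpoly K[n]} -> Prop} (hF : minimal_graded_free_resolution F I).

(** The augmentation sends the basis of F_0 to nonzero terms c_k x^(b_k): a
    basis element mapped to 0 would be a syzygy with coordinate 1, and the
    coordinates of syzygies have no constant term. *)
Lemma aug_monomial :
  exists (b : 'I_(res_rank F 0) -> 'X_{1..n}) (c : 'I_(res_rank F 0) -> K),
    forall k, [/\ c k != 0, res_aug F k 0 = c k *: 'X_[b k]
                & multidegree (b k) = res_shift k].
Proof.
have [[hmg _] [_ exact0 _] hmin] := hF.
have aug_neq0 k : res_aug F k 0 != 0.
  apply/eqP => Ak.
  have [w eqw] : exists w, (delta_mx 0 k : 'rV_(_)) = w *m res_diff F 0.
    by apply/exact0; apply/rowP => j; rewrite ord1 -rowE !mxE.
  move/(congr1 (fun z : 'rV_(_) => (z 0 k)@_0%MM)): eqw => /=.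
  rewrite (mulmx_mcoeff0 _ (fun j => hmin _ j k)) mxE !eqxx /= mcoeff1 eqxx.
  by move/eqP; rewrite oner_eq0.
have /fin_all_exists[b hb] k : exists b : 'X_{1..n}, [/\ (res_aug F k 0)@_b != 0,
    res_aug F k 0 = (res_aug F k 0)@_b *: 'X_[b] & multidegree b = res_shift k].
  have := aug_neq0 k; rewrite -msupp_eq0; case Es: (msupp _) => [//|b s] _.
  have bA : b \in msupp (res_aug F k 0) by rewrite Es mem_head.
  exists b; split; [by rewrite -mcoeff_msupp | | exact: hmg].
  apply: mpoly_monomialE => m mA; apply: multidegree_inj.
  by rewrite (hmg _ _ mA) (hmg _ _ bA).
by exists b, (fun k => (res_aug F k 0)@_(b k)).
Qed.

Context {b : 'I_(res_rank F 0) -> 'X_{1..n}} {c : 'I_(res_rank F 0) -> K}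
  (c_neq0 : forall k, c k != 0)
  (augE : forall k, res_aug F k 0 = c k *: 'X_[b k])
  (shift0E : forall k, multidegree (b k) = res_shift k).

(** The element of F_0 supported on the k-th basis vector that the augmentation
    sends to p x^(b_k). *)
Definition basis_elt k (p : {mpoly K[n]}) : 'rV_(res_rank F 0) :=
  ((c k)^-1 *: p) *: delta_mx 0 k.

Lemma basis_eltM k p q : basis_elt k (p * q) = p *: basis_elt k q.
Proof. by rewrite /basis_elt scalerA scalerAr. Qed.

Lemma basis_eltE k p l :
  basis_elt k p 0 l = if l == k then (c k)^-1 *: p else 0.
Proof. by rewrite !mxE eqxx /=; case: eqP; rewrite ?mulr1 ?mulr0. Qed.

Lemma basis_elt_aug k p : basis_elt k p *m res_aug F = (p * 'X_[b k])%:M.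
Proof.
apply/rowP => j; rewrite ord1 -scalemxAl -rowE !mxE augE /= mulr1n.
by rewrite -scalerAl -scalerAr scalerA mulVf // scale1r.
Qed.

Lemma basis_elt_syzygy k l p q : p * 'X_[b k] = q * 'X_[b l] ->
  exists w, basis_elt k p - basis_elt l q = w *m res_diff F 0.
Proof.
move=> eq_pq; have [_ [_ exact0 _] _] := hF.
by apply/exact0; rewrite mulmxBl !basis_elt_aug eq_pq subrr.
Qed.

(** Otherwise x^(b_l - b_k) e_k - e_l would give, after scaling e_k and e_l, a
    syzygy with a nonzero constant coordinate. *)
Lemma gens_antichain k l : (b k <= b l)%MM -> k = l.
Proof.
move=> le_kl; apply/eqP; apply: contraT => neq_kl.
have [w] : exists w, basis_elt k 'X_[b l - b k] - basis_elt l 1 = w *m res_diff F 0.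
  by apply: basis_elt_syzygy; rewrite -mpolyXD submK // mul1r.
move=> /(congr1 (fun z : 'rV_(_) => (z 0 l)@_0%MM)) /=.
have [_ _ hmin] := hF.
rewrite (mulmx_mcoeff0 _ (fun j => hmin _ j l)) mxE [X in _ + X]mxE !basis_eltE eqxx.
rewrite eq_sym (negbTE neq_kl) add0r mcoeffN mcoeffZ mcoeff1 eqxx mulr1.
by move/eqP; rewrite oppr_eq0 invr_eq0 (negbTE (c_neq0 l)).
Qed.

Lemma gens_in k : I 'X_[b k].
Proof.
have [_ [defI _ _] _] := hF; apply/defI; exists (basis_elt k 1).
by rewrite basis_elt_aug mxE eqxx mulr1n mul1r.
Qed.

Lemma gens_generate m : I 'X_[m] -> exists k, (b k <= m)%MM.
Proof.
have [_ [defI _ _] _] := hF; move=> /defI[v eqX].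
have: m \in msupp ('X_[m] : {mpoly K[n]}) by rewrite msuppX inE.
rewrite {1}eqX mxE => /msupp_sum_le/flattenP[_ /mapP[k _ ->]].
rewrite augE -scalerAr => /msuppZ_le.
rewrite (perm_mem (msuppMX _ _)) => /mapP[v' _ ->].
by exists k; apply: lem_addr.
Qed.

Lemma minimal_generatorP m : minimal_generator I m <-> exists k, m = b k.
Proof.
split=> [[/gens_generate[k le_km] min_m] | [k ->]].
  by exists k; rewrite (min_m _ (gens_in k) le_km).
split=> [|m' /gens_generate[l le_lm'] le_m'k]; first exact: gens_in.
have elk := gens_antichain (lepm_trans le_lm' le_m'k).
rewrite elk in le_lm'.
by apply/mnmP => i; apply/eqP; rewrite eqn_leq (mnm_lepP le_lm') (mnm_lepP le_m'k).
Qed.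

Context (heq : equigenerated I) (BI : squarefree_Borel I).

Lemma gens_squarefree k : squarefree (b k).
Proof.
have [[M [sM defI]] _] := BI.
have /defI/monomial_idealX[m Mm le_mk] := gens_in k.
have /minimal_generatorP[_ minb] : exists l, b k = b l by exists k.
rewrite -(minb m _ le_mk); first exact: sM.
by apply/defI/monomial_idealX; exists m => //; apply: lepm_refl.
Qed.

(** Equigeneration enters here: a move of a minimal generator stays in I and has
    the generating degree, so it is a minimal generator. *)
Lemma gens_bmove k (s t : 'I_n) : (s < t)%N -> b k s = 0%N -> (0 < b k t)%N ->
  exists l, b l = bmove s t (b k).
Proof.
move=> lt_st ks kt.
have := squarefree_Borel_closed BI (conj (gens_squarefree k) (gens_in k)) lt_st ks kt.
move=> [_ /gens_generate[l le_l]]; exists l; apply: lepm_mdeg_eq => //.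
by rewrite mdeg_bmove //; apply: heq; apply/minimal_generatorP; [exists l | exists k].
Qed.

(** Every x_i v, v a minimal generator and i a gap of v, is the multidegree of a
    basis element of F_1. *)
Lemma gap_multiple_shift w : gap_multiples (minimal_generator I) w ->
  exists j : 'I_(res_rank F 1), res_shift j = multidegree w.
Proof.
have [[_ hmg] _ hmin] := hF.
move=> [_ [i [/minimal_generatorP[k ->] [ki [t lt_it kt]] ->]]].
have [l bl] := gens_bmove lt_it ki kt.
have neq_kl : k != l.
  by apply: contraTneq kt => ekl; have := congr1 (fun m : 'X_{1..n} => m i) bl;
     rewrite -ekl ki bmoveE eqxx.
have [y /(congr1 (fun z : 'rV_(_) => z 0 k)) /=] :
    exists y, basis_elt k 'X_i - basis_elt l 'X_t = y *m res_diff F 0.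
  by apply: basis_elt_syzygy; rewrite -!mpolyXD bl bmoveK.
rewrite mxE [X in _ + X]mxE !basis_eltE eqxx (negbTE neq_kl) subr0 mxE.
move=> /(congr1 (fun p : {mpoly K[n]} => U_(i)%MM \in msupp p)).
rewrite (perm_mem (msuppZ _ _)) ?invr_eq0 // msuppX inE eqxx => /esym.
move=> /msupp_sum_le/flattenP[_ /mapP[j _ ->]] /msuppM_le/allpairsP[[m1 m2]] /=.
move=> [_ m2D eqU]; exists j; rewrite -(hmg _ _ _ _ m2D) multidegreeD shift0E.
congr (_ + _).
have m2_neq0 : m2 != 0%MM.
  by apply: contraTneq m2D => ->; rewrite mcoeff_msupp hmin eqxx.
congr multidegree; apply: lepm_mdeg_eq; first by rewrite eqU lem_addl.
have := congr1 mdeg eqU; rewrite mdegD mdeg1 -mdeg_eq0 in m2_neq0 *; lia.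
Qed.

(** The product of the maximal ideal (x_1, ..., x_n) and the module of
    syzygies. *)
Definition max_syzygy (z : 'rV[{mpoly K[n]}]_(res_rank F 0)) : Prop :=
  exists2 w : 'rV_(_), forall j, (w 0 j)@_0%MM = 0 & z = w *m res_diff F 0.

Lemma max_syzygy0 : max_syzygy 0.
Proof. by exists 0; rewrite ?mul0mx // => j; rewrite mxE mcoeff0. Qed.

Lemma max_syzygyD z z' : max_syzygy z -> max_syzygy z' -> max_syzygy (z + z').
Proof.
move=> [w w0 ->] [w' w'0 ->]; exists (w + w'); rewrite ?mulmxDl // => j.
by rewrite mxE mcoeffD w0 w'0 addr0.
Qed.

Lemma max_syzygyZ p z : max_syzygy z -> max_syzygy (p *: z).
Proof.
move=> [w w0 ->]; exists (p *: w); rewrite ?scalemxAl // => j.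
by rewrite mxE mcoeff0M w0 mulr0.
Qed.

Lemma max_syzygyN z : max_syzygy z -> max_syzygy (- z).
Proof. by rewrite -scaleN1r; apply: max_syzygyZ. Qed.

Lemma max_syzygy_trans x y z :
  max_syzygy (x - y) -> max_syzygy (y - z) -> max_syzygy (x - z).
Proof. by move=> xy yz; rewrite -(subrK y x) -addrA; apply: max_syzygyD. Qed.

(** The images of the basis of F_1 are minimal generators of the syzygies: a
    basis element e_j with the same image as some w without constant terms would
    make e_j - w a second syzygy with constant term 1 in its j-th coordinate. *)
Lemma res_diff_not_max_syzygy j : ~ max_syzygy (row j (res_diff F 0)).
Proof.
have [_ [_ _ exactS] hmin] := hF.
move=> [w w0 eq_row].
have [y eqy] : exists y, (delta_mx 0 j - w : 'rV_(_)) = y *m res_diff F 1.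
  by apply/exactS; rewrite mulmxBl -rowE eq_row subrr.
move/(congr1 (fun z : 'rV_(_) => (z 0 j)@_0%MM)): eqy => /=.
rewrite (mulmx_mcoeff0 _ (fun i => hmin _ i j)) !mxE mcoeffB w0.
rewrite !eqxx mcoeff1 eqxx subr0.
by move/eqP; rewrite oner_eq0.
Qed.

(** Two distinct generators dividing x^a are joined by moves inside supp(a): a
    variable x_s of the second missing from the first, and x_t of the first
    missing from the second, allow a move on the first if s < t and on the second
    if t < s.  Moves lower the weight of the generators, so this terminates. *)
Lemma gens_connected a :
    ~ gap_multiples (minimal_generator I) a ->
  forall k l, (b k <= a)%MM -> (b l <= a)%MM ->
  max_syzygy (basis_elt k 'X_[a - b k] - basis_elt l 'X_[a - b l]).
Proof.
move=> not_a.
have step k (s t : 'I_n) : (b k <= a)%MM -> (s < t)%N -> b k s = 0%N -> (0 < b k t)%N ->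
    (0 < a s)%N -> exists l, [/\ b l = bmove s t (b k), (b l <= a)%MM &
      max_syzygy (basis_elt k 'X_[a - b k] - basis_elt l 'X_[a - b l])].
  move=> /mnm_lepP le_ka lt_st ks kt as_gt0.
  have [l bl] := gens_bmove lt_st ks kt; exists l.
  have le_a : (U_(s) + b k <= a)%MM.
    apply/mnm_lepP => x; rewrite mnmDE mnm1E.
    by have := le_ka x; case: (eqVneq s x) => [<-|_] /=; rewrite ?ks; lia.
  have bl2 := bmoveK s kt; rewrite -bl in bl2.
  split=> //.
    by apply: lepm_trans le_a; rewrite -bl2 lem_addl.
  have -> := subm_addK le_a.
  have -> : (a - b l = (a - (U_(s) + b k)) + U_(t))%MM.
    by rewrite -bl2; apply: subm_addK; rewrite bl2.
  (* The difference is x^(a - x_s b_k) times a linear syzygy, and the monomial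
     is not 1 because a is not of the form x_s b_k. *)
  rewrite !mpolyXD !basis_eltM -scalerBr.
  have [|y ->] := @basis_elt_syzygy k l 'X_s 'X_t; first by rewrite -!mpolyXD bl2.
  exists ('X_[a - (U_(s) + b k)] *: y); rewrite ?scalemxAl // => j.
  rewrite mxE mcoeff0M mcoeffX; case: eqP => [eq0|_]; last by rewrite mul0r.
  case: not_a; exists (b k), s; split; first by apply/minimal_generatorP; exists k.
    by split=> //; exists t.
  by rewrite -[LHS](submK le_a) eq0 add0m.
have wgt_step k l (s t : 'I_n) : (s < t)%N -> (0 < b k t)%N -> b l = bmove s t (b k) ->
    (mnmwgt (b l) < mnmwgt (b k))%N.
  move=> lt_st kt eql; have := congr1 mnmwgt (bmoveK s kt).
  by rewrite -eql !mnmwgtD !mnmwgt1; lia.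
have ex_lt k l : k != l -> exists s, (b k s < b l s)%N.
  move=> neq_kl; apply/existsP; apply: contraT => /existsPn le_lk.
  have /gens_antichain elk : (b l <= b k)%MM.
    by apply/mnm_lepP => s; rewrite leqNgt.
  by rewrite elk eqxx in neq_kl.
move=> k l; have [N] := ubnP (mnmwgt (b k) + mnmwgt (b l)).
elim: N k l => // N IH k l; rewrite ltnS => le_N le_ka le_la.
have [-> | neq_kl] := eqVneq k l; first by rewrite subrr; apply: max_syzygy0.
have [s lt_s] := ex_lt _ _ neq_kl.
have [t lt_t] : exists t, (b l t < b k t)%N by apply: ex_lt; rewrite eq_sym.
have ks : b k s = 0%N by have := gens_squarefree l s; lia.
have lt_l : b l t = 0%N by have := gens_squarefree k t; lia.
have as_gt0 : (0 < a s)%N by have := mnm_lepP le_la s; lia.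
have at_gt0 : (0 < a t)%N by have := mnm_lepP le_ka t; lia.
have [lt_st | lt_ts | /val_inj est] := ltngtP s t; last by rewrite est in lt_s; lia.
- have kt : (0 < b k t)%N by lia.
  have [k' [bk' le_k'a kk']] := step k s t le_ka lt_st ks kt as_gt0.
  have := wgt_step _ _ _ _ lt_st kt bk'.
  by move=> lt_wgt; apply: (max_syzygy_trans kk'); apply: IH => //; lia.
- have ls : (0 < b l s)%N by lia.
  have [l' [bl' le_l'a ll']] := step l t s le_la lt_ts lt_l ls at_gt0.
  have := wgt_step _ _ _ _ lt_ts ls bl'.
  move=> lt_wgt.
  have kl' : max_syzygy (basis_elt k 'X_[a - b k] - basis_elt l' 'X_[a - b l']).
    by apply: IH => //; lia.
  by apply: (max_syzygy_trans kl'); have := max_syzygyN ll'; rewrite opprB.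
Qed.

(** Conversely, every basis element of F_1 has such a multidegree. *)
Lemma shift_gap_multiple (j : 'I_(res_rank F 1)) :
  exists2 w, gap_multiples (minimal_generator I) w & res_shift j = multidegree w.
Proof.
have [[_ hmg] [_ exact0 _] _] := hF.
pose D := res_diff F 0.
have [k0 Dk0] : exists k0, D j k0 != 0.
  apply/existsP; apply: contraT => /existsPn D0.
  case: (@res_diff_not_max_syzygy j); have -> : row j D = 0.
    by apply/rowP => k; rewrite !mxE; apply/eqP; rewrite -[_ == _]negbK D0.
  exact: max_syzygy0.
move: Dk0; rewrite -msupp_eq0; case Em: (msupp _) => [//|m ms] _.
have mD : m \in msupp (D j k0) by rewrite Em mem_head.
pose a := (m + b k0)%MM.
have aE : multidegree a = res_shift j by rewrite -(hmg _ _ _ _ mD) multidegreeD shift0E.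
have Dsupp k m' : m' \in msupp (D j k) -> (m' + b k)%MM = a.
  move=> m'D; apply: multidegree_inj.
  by rewrite aE -(hmg _ _ _ _ m'D) multidegreeD shift0E.
(* The image of the j-th basis element, homogeneous of multidegree a, is the sum
   of the mu_k times the lifts of x^a along the generators b_k dividing x^a. *)
pose mu k := if (b k <= a)%MM then c k * (D j k)@_(a - b k) else 0.
have DE k : D j k = (mu k)%:MP * ((c k)^-1 *: 'X_[a - b k]).
  rewrite mul_mpolyC scalerA /mu; case: ifP => le_ka.
    rewrite mulrAC mulfV // mul1r; apply: mpoly_monomialE => m' /Dsupp <-.
    by rewrite addmK.
  rewrite mul0r scale0r; apply: msuppnil0; case E: (msupp _) => [//|m' s].
  have /Dsupp e : m' \in msupp (D j k) by rewrite E mem_head.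
  by move: le_ka; rewrite -e lem_addl.
have rowE' : row j D = \sum_k (mu k)%:MP *: basis_elt k 'X_[a - b k].
  rewrite [LHS]row_sum_delta; apply: eq_bigr => k _.
  by rewrite mxE DE /basis_elt scalerA.
have sum_mu : \sum_k mu k = 0.
  have : row j D *m res_aug F = 0.
    by apply/exact0; exists (delta_mx 0 j); rewrite -rowE.
  rewrite rowE' mulmx_suml => /(congr1 (fun z : 'M_(1,1) => (z 0 0)@_a)).
  rewrite summxE raddf_sum /= mxE mcoeff0 => sum0; rewrite -[RHS]sum0.
  apply: eq_bigr => k _.
  rewrite -scalemxAl basis_elt_aug !mxE eqxx mulr1n mul_mpolyC mcoeffZ.
  rewrite /mu; case: ifP => [le_ka | _]; last by rewrite mul0r.
  by rewrite -mpolyXD submK // mcoeffX eqxx mulr1.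
case: (boolP [exists k, exists i, gap (b k) i && (a == U_(i) + b k)%MM]).
  move=> /existsP[k /existsP[i /andP[/gapP gap_i /eqP ea]]]; exists a => //.
  by exists (b k), i; split=> //; apply/minimal_generatorP; exists k.
move=> no_gap; case: (@res_diff_not_max_syzygy j).
have not_a : ~ gap_multiples (minimal_generator I) a.
  move=> [_ [i [/minimal_generatorP[k ->] /gapP gap_i ea]]].
  by case/negP: no_gap; apply/existsP; exists k;
     apply/existsP; exists i; rewrite gap_i ea /=.
have le_k0 : (b k0 <= a)%MM by apply: lem_addl.
(* The coefficients mu_k add up to 0, so any fixed lift can be subtracted. *)
have -> : row j D =
    \sum_k (mu k)%:MP *: (basis_elt k 'X_[a - b k] - basis_elt k0 'X_[a - b k0]).
  under [RHS]eq_bigr do rewrite scalerBr.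
  rewrite sumrB -scaler_suml -raddf_sum sum_mu raddf0 scale0r subr0; exact: rowE'.
apply: (big_ind max_syzygy); [exact: max_syzygy0 | exact: max_syzygyD |] => k _.
rewrite /mu; case: ifP => [le_ka|_]; first by apply: max_syzygyZ; apply: gens_connected.
by rewrite scale0r; apply: max_syzygy0.
Qed.

End MinimalResolution.

Theorem proposition4p1 (K : fieldType) (n m : nat) (u : 'I_m -> 'X_{1..n})
    (I : {mpoly K[n]} -> Prop) (F : graded_free_sequence K n)
    (hu : forall i, squarefree (u i))
    (hI : is_B1 (fun v => exists i, v = u i) I)
    (hgen : forall i, minimal_generator I (u i))
    (heq : equigenerated I)
    (hF : minimal_graded_free_resolution F I) :
  is_B1 (fun v => exists (i : 'I_m) (p : 'I_n),
           maximal_gap (u i) p /\ v = (U_(p) + u i)%MM)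
        (HS F 1).
Proof.
have [BI _ _] := hI.
have [b [c bcP]] := aug_monomial hF.
have c_neq0 k : c k != 0 by have [] := bcP k.
have augE k : res_aug F k 0 = c k *: 'X_[b k] by have [] := bcP k.
have shiftE k : multidegree (b k) = res_shift k by have [] := bcP k.
have genP := minimal_generatorP hF c_neq0 augE.
have HS_gen w : (exists j : 'I_(res_rank F 1), res_shift j = multidegree w) <->
    gap_multiples (minimal_generator I) w.
  split=> [[j ej] | gw]; last exact: (gap_multiple_shift hF c_neq0 augE shiftE).
  have [w' gw' ej'] := shift_gap_multiple hF c_neq0 augE shiftE heq BI j.
  by rewrite (multidegree_inj (etrans (esym ej) ej')).
have sG w : minimal_generator I w -> squarefree w.
  by move=> /genP[k ->]; apply: (gens_squarefree hF c_neq0 augE).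
have cG : Borel_closed (minimal_generator I).
  move=> w s t /genP[k ->] lt_st ks kt; apply/genP.
  by have [l <-] := gens_bmove hF c_neq0 augE heq BI lt_st ks kt; exists l.
split.
- apply: squarefree_Borel_ideal => [w /HS_gen | w s t /HS_gen gw lt_st ws wt].
    exact: squarefree_gap_multiples.
  by apply/HS_gen; apply: Borel_closed_gap_multiples.
- move=> _ [i [p [[/gapP gap_p _] ->]]].
  apply/monomial_idealX; exists (U_(p) + u i)%MM; last exact: lepm_refl.
  by apply/HS_gen; exists (u i), p.
- move=> J BJ VJ; apply: squarefree_monomial_ideal_sub; first by case: BJ.
  move=> w /HS_gen.
  apply: (gap_multiples_B1 _ hI BJ) => [_ [i ->] // | _ p [i ->] gap_p].
  by apply: VJ; exists i, p.
Qed.
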